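(* The groups $\Pi_6(\mathbf{k},\mathbf{k}')$ have the $R_\infty$ property.
   Context: Let $A=[\ell_{ij}]\in\mathrm{SL}(2,\mathbb{Z})$ have trace $>2$. For $\mathbf{x}=(x,y)^t\in\mathbb{Z}^2$ write $\mathbf{a}^{\mathbf{x}}=a_1^xa_2^y$; for an integer matrix $B=[b_{ij}]$ write $B(a_i)=a_1^{b_{1i}}a_2^{b_{2i}}$. Kernels and images of integer matrices are taken on $\mathbb{Z}^2$; parameters lying in quotient groups are given by representatives in $\mathbb{Z}^2$. Assume $A$ has the integer square root $$N=-\frac{1}{\sqrt{\ell_{11}+\ell_{22}+2}}\begin{bmatrix}\ell_{11}+1&\ell_{12}\\ \ell_{21}&\ell_{22}+1\end{bmatrix};$$ let $M$ be a traceless integer matrix with determinant $-1$ and $MAM^{-1}=A^{-1}$, and let $(\mathbf{k},\mathbf{k}'-\mathbf{k})\in\frac{\ker(I-M)}{\mathrm{im}(I+M)}\oplus\frac{\ker(N-M)}{\mathrm{im}(N^{-1}+M)}$. Then $$\Pi_6(\mathbf{k},\mathbf{k}')=\langle a_1,a_2,\alpha,\beta\mid [a_1,a_2]=1,\ \alpha a_i\alpha^{-1}=N(a_i),\ \beta a_i\beta^{-1}=M(a_i),\ \beta^2=\mathbf{a}^{\mathbf{k}},\ \beta\alpha\beta^{-1}=\mathbf{a}^{\mathbf{k}'}\alpha^{-1}\rangle.$$ The Reidemeister number $R(\varphi)$ of an endomorphism $\varphi$ of a group $G$ is the number (possibly $\infty$) of equivalence classes of the relation $\alpha\sim\gamma\alpha\varphi(\gamma)^{-1}$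 ($\gamma\in G$) on $G$. $G$ has the $R_\infty$ property if $R(\varphi)=\infty$ for every automorphism $\varphi$ of $G$. *)

(* Defs.v *)
From HB Require Import structures.
From mathcomp Require Import all_boot all_order all_algebra.
From mathcomp Require Import finmap.
From mathcomp Require Import boolp classical_sets functions cardinality.
From mathcomp Require Import constructive_ereal reals.

Set Implicit Arguments.
Unset Strict Implicit.
Unset Printing Implicit Defensive.

Import Order.TTheory GRing.Theory Num.Theory.
Local Open Scope quotient_scope.
Local Open Scope group_scope.

(* Words in the letters [x] (encoded as [(x, true)]) and [x^-1] (encoded as
   [(x, false)]), not necessarily reduced. *)
Definition word (X : Type) : Type := seq (X * bool).

Section Words.
Context {X : choiceType}.
Implicit Types u v w : word X.

HB.instance Definition _ := Choice.copy (word X) (seq (X * bool)).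

Definition word_inv u : word X := rev [seq (l.1, ~~ l.2) | l <- u].

Fact word_invK : involutive word_inv.
Proof.
move=> u; rewrite /word_inv map_rev revK -map_comp.
by rewrite -[RHS]map_id; apply: eq_map => -[x b] /=; rewrite negbK.
Qed.

Fact word_inv_cat u v : word_inv (u ++ v) = word_inv v ++ word_inv u.
Proof. by rewrite /word_inv map_cat rev_cat. Qed.

HB.instance Definition _ := isStarMonoid.Build (word X)
  (@catA _) (@cat0s _) word_invK word_inv_cat.

Definition letter (x : X) : word X := [:: (x, true)].

Definition wexpz u (n : int) : word X :=
  match n with Posz m => u ^+ m | Negz m => u ^- m.+1 end.

End Words.

Section Presentation.
Context {X : choiceType}.
Variable rels : word X -> word X -> Prop.

(* Equality of two words in the group <X | u = v for rels u v>: the least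
   congruence on words containing free cancellation and the relations. *)
Inductive pres_congr : word X -> word X -> Prop :=
| PresRel u v : rels u v -> pres_congr u v
| PresCancel x b : pres_congr [:: (x, b); (x, ~~ b)] 1
| PresRefl u : pres_congr u u
| PresSym u v : pres_congr u v -> pres_congr v u
| PresTrans u v w : pres_congr u v -> pres_congr v w -> pres_congr u w
| PresMul u u' v v' :
    pres_congr u u' -> pres_congr v v' -> pres_congr (u * v) (u' * v').

Definition pres_eqv (u v : word X) : bool := `[< pres_congr u v >].

Fact pres_eqv_refl : reflexive pres_eqv.
Proof. by move=> u; apply/asboolP; exact: PresRefl. Qed.

Fact pres_eqv_sym : symmetric pres_eqv.
Proof. by move=> u v; apply/asboolP/asboolP; exact: PresSym. Qed.

Fact pres_eqv_trans : transitive pres_eqv.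
Proof.
by move=> v u w /asboolP uv /asboolP vw; apply/asboolP; exact: PresTrans uv vw.
Qed.

Canonical pres_equiv := EquivRel pres_eqv
  pres_eqv_refl pres_eqv_sym pres_eqv_trans.

Definition presented : Type := {eq_quot pres_equiv}.
HB.instance Definition _ := Choice.on presented.
HB.instance Definition _ := Quotient.on presented.

Lemma pres_piP u v : \pi_presented u = \pi_presented v <-> pres_congr u v.
Proof.
split=> [e|/asboolP e]; last exact/(@eqmodP _ pres_equiv u v).
by apply/asboolP/(@eqmodP _ pres_equiv u v).
Qed.

Lemma pres_congrV u : pres_congr (u^-1 * u) 1.
Proof.
elim: u => [|[x b] u IHu]; first exact: PresRefl.
pose y : word X := [:: (x, ~~ b); (x, ~~ ~~ b)]; pose u' : word X := u.
have -> : ((x, b) :: u : word X)^-1 * ((x, b) :: u : word X)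
          = u'^-1 * (y * u').
  rewrite /y negbK -[LHS]/(word_inv ([:: (x, b)] ++ u) ++ _) word_inv_cat.
  by rewrite -catA.
apply: PresTrans IHu; apply: PresMul; first exact: PresRefl.
by have := PresMul (PresCancel x (~~ b)) (PresRefl u'); rewrite mul1g.
Qed.

Lemma pres_congr_inv u v : pres_congr u v -> pres_congr u^-1 v^-1.
Proof.
move=> uv; rewrite -[in X in pres_congr X _](mulg1 u^-1).
apply: (@PresTrans _ (u^-1 * (v * v^-1))).
  apply: PresMul; first exact: PresRefl.
  by apply: PresSym; have := pres_congrV v^-1; rewrite invgK.
rewrite mulgA -[in X in pres_congr _ X](mul1g v^-1).
apply: PresMul; last exact: PresRefl.
apply: PresTrans (pres_congrV u).
by apply: PresMul; [exact: PresRefl | exact: PresSym].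
Qed.

Definition pres_mul (p q : presented) : presented :=
  \pi_presented (repr p * repr q).
Definition pres_one : presented := \pi_presented 1.
Definition pres_inv (p : presented) : presented := \pi_presented (repr p)^-1.

Lemma pres_mul_pi u v :
  pres_mul (\pi_presented u) (\pi_presented v) = \pi_presented (u * v).
Proof.
by apply/pres_piP/PresMul; apply/pres_piP; rewrite reprK.
Qed.

Lemma pres_inv_pi u : pres_inv (\pi_presented u) = \pi_presented u^-1.
Proof. by apply/pres_piP/pres_congr_inv/pres_piP; rewrite reprK. Qed.

Fact pres_mulA : associative pres_mul.
Proof.
move=> p q r; rewrite -[p]reprK -[q]reprK -[r]reprK.
by rewrite !pres_mul_pi !reprK mulgA.
Qed.

Fact pres_mul1 : left_id pres_one pres_mul.
Proof. by move=> p; rewrite -[p]reprK pres_mul_pi mul1g. Qed.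

Fact pres_mulr1 : right_id pres_one pres_mul.
Proof. by move=> p; rewrite -[p]reprK pres_mul_pi mulg1. Qed.

Fact pres_mulV : left_inverse pres_one pres_inv pres_mul.
Proof.
by move=> p; rewrite -[p]reprK pres_inv_pi pres_mul_pi; apply/pres_piP/pres_congrV.
Qed.

Fact pres_mulrV : right_inverse pres_one pres_inv pres_mul.
Proof.
move=> p; rewrite -[p]reprK pres_inv_pi pres_mul_pi; apply/pres_piP.
by have := pres_congrV (repr p)^-1; rewrite invgK.
Qed.

HB.instance Definition _ := isGroup.Build presented
  pres_mulA pres_mul1 pres_mulr1 pres_mulV pres_mulrV.

End Presentation.

Section Reidemeister.
Variables (G : groupType) (phi : G -> G).

Definition twisted_conj (x y : G) : Prop := exists g, y = g * x * (phi g)^-1.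

Definition reidemeister_classes : set (set G) :=
  range (fun x => [set y | twisted_conj x y]%classic).

Definition reidemeister_number : \bar nat :=
  if `[< finite_set reidemeister_classes >]
  then (#|` fset_set reidemeister_classes|)%:E%E else +oo%E.

End Reidemeister.

Definition R_infinity (G : groupType) : Prop :=
  forall phi : {multiplicative G -> G}, bijective phi ->
  reidemeister_number phi = +oo%E.

(* [pi6_a 0], [pi6_a 1] are the paper's a_1, a_2. *)
Inductive pi6_gen := pi6_a of 'I_2 | pi6_alpha | pi6_beta.

Definition pi6_gen_encode (x : pi6_gen) : 'I_2 + bool :=
  match x with
  | pi6_a i => inl i | pi6_alpha => inr true | pi6_beta => inr false
  end.
Definition pi6_gen_decode (y : 'I_2 + bool) : pi6_gen :=
  match y with
  | inl i => pi6_a i | inr true => pi6_alpha | inr false => pi6_beta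
  end.
Fact pi6_gen_encodeK : cancel pi6_gen_encode pi6_gen_decode.
Proof. by case. Qed.
HB.instance Definition _ := Choice.copy pi6_gen (can_type pi6_gen_encodeK).

Definition pi6_word_a (i : 'I_2) : word pi6_gen := letter (pi6_a i).
Definition pi6_word_alpha : word pi6_gen := letter pi6_alpha.
Definition pi6_word_beta : word pi6_gen := letter pi6_beta.

Definition pi6_lattice (x : 'cV[int]_2) : word pi6_gen :=
  wexpz (pi6_word_a 0%R) (x 0%R 0%R) * wexpz (pi6_word_a 1%R) (x 1%R 0%R).

Section Pi6Relations.
Local Notation a := pi6_word_a.
Local Notation alpha := pi6_word_alpha.
Local Notation beta := pi6_word_beta.

(* The word B(a_i) is a^(col i B). *)
Inductive pi6_rel (N M : 'M[int]_2) (k k' : 'cV[int]_2) :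
    word pi6_gen -> word pi6_gen -> Prop :=
| Pi6Comm : pi6_rel N M k k' [~ a 0%R, a 1%R] 1
| Pi6Alpha i :
    pi6_rel N M k k' (alpha * a i * alpha^-1) (pi6_lattice (col i N))
| Pi6Beta i :
    pi6_rel N M k k' (beta * a i * beta^-1) (pi6_lattice (col i M))
| Pi6Beta2 : pi6_rel N M k k' (beta ^+ 2) (pi6_lattice k)
| Pi6BetaAlpha :
    pi6_rel N M k k' (beta * alpha * beta^-1) (pi6_lattice k' * alpha^-1).

End Pi6Relations.

Definition Pi6 (N M : 'M[int]_2) (k k' : 'cV[int]_2) : groupType :=
  presented (pi6_rel N M k k').

(* Main.v *)
Require Import Defs.
From HB Require Import structures.
From mathcomp Require Import all_boot all_order all_algebra.
From mathcomp Require Import boolp classical_sets cardinality.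
From mathcomp Require Import constructive_ereal reals ring zify.

Set Implicit Arguments.
Unset Strict Implicit.
Unset Printing Implicit Defensive.

Import Order.TTheory GRing.Theory Num.Theory.
Local Open Scope ring_scope.

(** Sending [a_1] and [a_2] to [1] projects the group onto the infinite
  dihedral group [D], generated by a translation [t] (the image of [alpha]) and
  a reflection (the image of [beta]).  The theorem comes down from [D]: every
  automorphism [phi] induces an automorphism of [D], and [D] has the R_infinity
  property.

  Let [p] be the projection and [f = p o phi], a homomorphism onto [D].  That
  [phi] descends to [D] means that [f] kills the lattice [Z^2] generated by the
  [a_i] ([image_lattice]).  Let [psi] be the restriction of [f] to [Z^2].
  Conjugation by [alpha] acts on [Z^2] as [N], so each [psi ((N - I) x)] is a
  commutator, hence a translation.  On translations conjugation by [f alpha] is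
  [y |-> y^e] with [e = 1] or [e = -1], so [psi] vanishes on the image of
  [(N - e I) (N - I)].  Since [N^2 = A] with [tr A > 2], neither [1] nor [-1] is
  an eigenvalue of [N] ([sqrt_eigenvalues]), so that image has finite index and
  [psi] has torsion values ([zlat_torsion]).  An element of finite order in [D]
  is trivial or a reflection, and an abelian subgroup of such elements has at
  most one reflection [r].  If [r] occurred, it would be centralized by
  everything in the image of [f], that is by [D], whereas [r] does not commute
  with [t] ([lattice_killed]).

  Hence [f] factors through [p].  The relations [beta^2 = 1] and
  [beta alpha beta^-1 = alpha^-1], valid modulo [Z^2], and surjectivity force
  [f alpha = t^e] with [e = 1] or [e = -1], and [f beta] to be a reflection
  ([factor_to_dih]).  For the induced endomorphism of [D], look at the
  translations when [e = 1] and at the reflections when [e = -1]: the twisted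
  class of the element [u |-> e u + n] meets this family in at most two
  elements, with shifts [n] and [- n - e z] for a constant [z]
  ([dih_endo_twisted]).  So there are infinitely many twisted classes in
  [D], and therefore in the group. *)

(** * Integer powers in a group *)
Section IntegerPowers.
Variable G : groupType.
Implicit Types g h : G.
Local Open Scope group_scope.

Definition zexp g (n : int) : G :=
  match n with Posz m => g ^+ m | Negz m => g ^- m.+1 end.

Lemma zexpS g n : zexp g (n + 1)%R = zexp g n * g.
Proof.
case: n => [m|[|m]].
- by rewrite -PoszD addn1 /= expgSr.
- by rewrite /= expg1 mulVg.
have -> : (Negz m.+1 + 1)%R = Negz m by rewrite !NegzE; lia.
by rewrite /= (expgS g m.+1) invgM mulgVK.
Qed.

Lemma zexp_additive (V : zmodType) (psi : V -> G) :
    (forall x y, psi (x + y)%R = psi x * psi y) ->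
  forall x n, psi (x *~ n)%R = zexp (psi x) n.
Proof.
move=> psiD x; have psi0 : psi 0%R = 1.
  by apply: (mulgI (psi 0%R)); rewrite -psiD addr0 mulg1.
have psiX m : psi (x *+ m)%R = psi x ^+ m.
  by elim: m => [|m IH]; rewrite ?mulr0n ?psi0 // mulrS psiD IH expgS.
case=> m; first exact: psiX.
apply: (mulgI (psi (x *+ m.+1)%R)).
by rewrite -psiD NegzE mulrNz subrr psi0 psiX mulgV.
Qed.

Lemma zexpD g m n : zexp g (m + n)%R = zexp g m * zexp g n.
Proof.
elim/int_ind: n => [|n IH|n IH]; first by rewrite addr0 mulg1.
  by rewrite -addn1 PoszD addrA !zexpS IH mulgA.
apply: (mulIg g); rewrite -mulgA -!zexpS -[n.+1]addn1 PoszD opprD addrA.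
by rewrite !subrK.
Qed.

Lemma commute_zexp g h n : commute g h -> commute g (zexp h n).
Proof.
by move=> gh; case: n => m /=; [|apply: commuteV]; apply: commuteX.
Qed.

Lemma zexp_conj c g n : c * zexp g n * c^-1 = zexp (c * g * c^-1) n.
Proof.
rewrite -[LHS](_ : (fun m => c * zexp g m * c^-1) (1 *~ n)%R = _).
  rewrite (@zexp_additive _ (fun m => c * zexp g m * c^-1)) //.
  by move=> x y; rewrite zexpD !mulgA mulgVK.
by rewrite /= intz.
Qed.

(** For commuting [g] and [h] this is the homomorphism from [Z^2] that maps the
  standard basis to [g] and [h]. *)
Definition zlat g h (x : 'cV[int]_2) : G :=
  zexp g (x 0%R 0%R) * zexp h (x 1%R 0%R).

Section CommutingPair.
Variables g h : G.
Hypothesis gh : commute g h.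

Lemma zlatD x y : zlat g h (x + y)%R = zlat g h x * zlat g h y.
Proof.
rewrite /zlat !mxE !zexpD !mulgA; congr (_ * _); rewrite -!mulgA; congr (_ * _).
exact/commute_zexp/commute_sym/commute_zexp.
Qed.

Lemma zlatN x : zlat g h (- x)%R = (zlat g h x)^-1.
Proof.
apply: (mulgI (zlat g h x)); rewrite -zlatD subrr mulgV /zlat !mxE.
exact: mulg1.
Qed.

Lemma zlat_mulz x n : zlat g h (x *~ n)%R = zexp (zlat g h x) n.
Proof. exact: (zexp_additive zlatD). Qed.

(** Conjugation by [c] is determined on the span of [g] and [h] by its effect on
  these two generators. *)
Lemma zlat_mul c (B : 'M[int]_2) :
    c * g * c^-1 = zlat g h (col 0%R B) ->
    c * h * c^-1 = zlat g h (col 1%R B) ->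
  forall x, c * zlat g h x * c^-1 = zlat g h (B *m x)%R.
Proof.
move=> cg ch x.
have -> : (B *m x)%R = (col 0 B *~ x 0 0 + col 1 B *~ x 1 0)%R.
  apply/colP=> i; rewrite !mxE big_ord_recl big_ord1.
  have -> : lift ord0 ord0 = 1%R :> 'I_2 by apply/val_inj.
  by rewrite -!scaler_int !mxE !intz mulrC [(B i 1 * _)%R]mulrC.
rewrite zlatD !zlat_mulz -cg -ch -!zexp_conj /zlat.
by rewrite !mulgA mulgVK.
Qed.

End CommutingPair.
End IntegerPowers.

(** * Homomorphisms out of a presented group *)
Section PresentedHom.
Variables (X : choiceType) (G : groupType).
Local Open Scope quotient_scope.
Local Open Scope group_scope.
Implicit Types (g : X -> G) (u v w : word X).

Definition weval g w : G :=
  foldr (fun l acc => (if l.2 then g l.1 else (g l.1)^-1) * acc) 1 w.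

Lemma wevalM g u v : weval g (u * v) = weval g u * weval g v.
Proof.
elim: u => [|l u IH]; first by rewrite /= !mul1g.
by rewrite -[LHS]/(_ * weval g ((u : word X) * v)) IH mulgA.
Qed.

Lemma wevalV g u : weval g u^-1 = (weval g u)^-1.
Proof.
elim: u => [|[x b] u IH]; first by rewrite /= invg1.
rewrite -[(_ :: u : word X)^-1]/(word_inv ([:: (x, b)] ++ u)) word_inv_cat.
rewrite -[_ ++ _]/((u : word X)^-1 * word_inv [:: (x, b)]) wevalM.
rewrite IH /= invgM mulg1; congr (_ * _).
by case: b => //=; rewrite invgK.
Qed.

Lemma weval_letter g x : weval g (letter x) = g x.
Proof. exact: mulg1. Qed.

Lemma wevalX g u n : weval g (u ^+ n) = weval g u ^+ n.
Proof. by elim: n => [//|n IH]; rewrite !expgS wevalM IH. Qed.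

Lemma weval_wexpz g u n : weval g (wexpz u n) = zexp (weval g u) n.
Proof. by case: n => m; rewrite /wexpz ?wevalV wevalX. Qed.

Variable rels : word X -> word X -> Prop.

Definition pres_gen x : presented rels := \pi_(presented rels) (letter x).

Lemma pres_piM u v :
  \pi_(presented rels) (u * v)
    = \pi_(presented rels) u * \pi_(presented rels) v.
Proof. by rewrite -[RHS]/(pres_mul _ _) pres_mul_pi. Qed.

Lemma pres_piV u : \pi_(presented rels) u^-1 = (\pi_(presented rels) u)^-1.
Proof. by rewrite -[RHS]/(pres_inv _) pres_inv_pi. Qed.

Lemma presented_ind (P : presented rels -> Prop) :
    (forall x, P (pres_gen x)) -> P 1 ->
    (forall x y, P x -> P y -> P (x * y)) -> (forall x, P x -> P x^-1) ->
  forall x, P x.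
Proof.
move=> Pg P1 PM PV x; rewrite -[x]reprK; elim: (repr x) => [|[y b] u IH] //.
rewrite -[_ :: u]/(([:: (y, b)] : word X) * (u : word X)) pres_piM.
apply: PM => //.
case: b; first exact: Pg.
by rewrite -[[:: _]]/((letter y)^-1) pres_piV; apply: PV; exact: Pg.
Qed.

Section Morphism.
Variable f : presented rels -> G.
Hypothesis fM : {morph f : x y / x * y}.

Lemma pres_morph1 : f 1 = 1.
Proof. by apply: (mulgI (f 1)); rewrite -fM !mulg1. Qed.

Lemma pres_morphV : {morph f : x / x^-1}.
Proof. by move=> x; apply: (mulgI (f x)); rewrite -fM !mulgV pres_morph1. Qed.

Lemma weval_pi w : f (\pi_(presented rels) w) = weval (f \o pres_gen) w.
Proof.
elim: w => [|[x b] u IH]; first by rewrite -[RHS]pres_morph1.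
rewrite -[_ :: u]/(([:: (x, b)] : word X) * (u : word X)) pres_piM.
rewrite fM wevalM IH; congr (_ * _); case: b => /=; rewrite mulg1 //.
by rewrite -[[:: _]]/((letter x)^-1) pres_piV pres_morphV.
Qed.

Lemma weval_rel u v :
  rels u v -> weval (f \o pres_gen) u = weval (f \o pres_gen) v.
Proof.
by move=> uv; rewrite -!weval_pi; congr (f _); apply/pres_piP; apply: PresRel.
Qed.

End Morphism.

Section Lift.
Variables (g : X -> G).
Hypothesis g_rels : forall u v, rels u v -> weval g u = weval g v.

Definition pres_lift (p : presented rels) : G := weval g (repr p).

Lemma pres_lift_pi u : pres_lift (\pi_(presented rels) u) = weval g u.
Proof.
have: pres_congr rels (repr (\pi_(presented rels) u)) u.
  by apply/pres_piP; rewrite reprK.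
rewrite /pres_lift; move: (repr _) => v; elim=> {u v} //.
- by move=> x []; rewrite /weval /= mulg1 ?mulgV ?mulVg.
- by move=> u v w _ -> _ ->.
- by move=> u u' v v' _ e _ e'; rewrite !wevalM e e'.
Qed.

Lemma pres_lift_gen x : pres_lift (pres_gen x) = g x.
Proof. by rewrite pres_lift_pi weval_letter. Qed.

Lemma pres_liftM : {morph pres_lift : x y / x * y}.
Proof.
move=> x y; rewrite -[x]reprK -[y]reprK -pres_piM !pres_lift_pi.
exact: wevalM.
Qed.

End Lift.
End PresentedHom.

(** * The infinite dihedral group *)

(** [Dih b x] is the isometry [u |-> (-1)^b u + x] of the integers. *)
Record dihedral := Dih { flip : bool; shift : int }.

Definition dih_pair p := (flip p, shift p).
Definition pair_dih q := Dih q.1 q.2.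
Fact dih_pairK : cancel dih_pair pair_dih. Proof. by case. Qed.
HB.instance Definition _ := Choice.copy dihedral (can_type dih_pairK).

Definition dih_mul p q :=
  Dih (flip p (+) flip q) (shift p + (-1) ^+ flip p * shift q).
Definition dih_inv p := Dih (flip p) (- ((-1) ^+ flip p * shift p)).

Fact dih_mulA : associative dih_mul.
Proof.
move=> [a x] [b y] [c z]; rewrite /dih_mul /= addbA; congr Dih.
by rewrite mulrDr addrA mulrA -signr_addb.
Qed.

Fact dih_mul1 : left_id (Dih false 0) dih_mul.
Proof. by move=> [a x]; rewrite /dih_mul /= add0r mul1r. Qed.

Fact dih_mulr1 : right_id (Dih false 0) dih_mul.
Proof. by move=> [a x]; rewrite /dih_mul /= addbF mulr0 addr0. Qed.

Fact dih_mulV : left_inverse (Dih false 0) dih_inv dih_mul.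
Proof. by move=> [a x]; rewrite /dih_mul /= addbb addNr. Qed.

Fact dih_mulrV : right_inverse (Dih false 0) dih_inv dih_mul.
Proof.
move=> [a x]; rewrite /dih_mul /= addbb mulrN mulrA -signr_addb addbb mul1r.
by rewrite subrr.
Qed.

HB.instance Definition _ := isGroup.Build dihedral
  dih_mulA dih_mul1 dih_mulr1 dih_mulV dih_mulrV.

Section Dihedral.
Local Open Scope group_scope.
Implicit Types (r u c : dihedral).

Lemma dihM a x b y :
  Dih a x * Dih b y = Dih (a (+) b) (x + (-1) ^+ a * y)%R.
Proof. by []. Qed.

Lemma dihV a x : (Dih a x)^-1 = Dih a (- ((-1) ^+ a * x))%R.
Proof. by []. Qed.

Lemma dih1 : (1 : dihedral) = Dih false 0. Proof. by []. Qed.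

Lemma zexp_translation x n : zexp (Dih false x) n = Dih false (x * n)%R.
Proof.
have transD y z : Dih false (y + z)%R = Dih false y * Dih false z.
  by rewrite dihM /= mul1r.
by rewrite -(zexp_additive transD) -mulrzr intz.
Qed.

(** Nontrivial translations have infinite order. *)
Lemma dih_torsion u n : n <> 0%R -> zexp u n = 1 -> u = 1 \/ flip u.
Proof.
case: u => [[] x] nz; [by right | move=> e; left; move: e].
rewrite zexp_translation dih1 => -[/eqP]; rewrite mulf_eq0 => /orP[] /eqP // ->.
by [].
Qed.

(** A reflection inverts translations and a translation centralizes them. *)
Lemma conj_translation c x :
  c * Dih false x * c^-1 = zexp (Dih false x) ((-1) ^+ flip c)%R.
Proof.
case: c => b y; rewrite zexp_translation dihM dihV dihM; congr Dih.
  by rewrite addbF addbb.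
by rewrite addbF mulrN mulrA -signr_addb addbb mul1r addrAC subrr add0r mulrC.
Qed.

Lemma reflection_invol r : flip r -> r * r = 1.
Proof. by case: r => [[] x] // _; rewrite dihM dih1 /= mulN1r subrr. Qed.

Lemma flipM u v : flip (u * v) = flip u (+) flip v. Proof. by []. Qed.

Lemma reflection_not_central r : flip r -> ~ commute r (Dih false 1).
Proof. by case: r => [[] x] // _; rewrite /commute !dihM /= => -[]; lia. Qed.

End Dihedral.

(** * Images of the lattice in the dihedral group *)
Section LatticeImage.
(* The images of [a_1], [a_2], [alpha] and [beta] are [g], [h], [c] and [d]. *)
Local Open Scope group_scope.
Variables (N M : 'M[int]_2) (g h c d : dihedral).
Hypothesis gh : commute g h.
Hypothesis cg : c * g * c^-1 = zlat g h (col 0%R N).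
Hypothesis ch : c * h * c^-1 = zlat g h (col 1%R N).
Hypothesis dg : d * g * d^-1 = zlat g h (col 0%R M).
Hypothesis dh : d * h * d^-1 = zlat g h (col 1%R M).
Hypothesis det_sub1 : (\det (N - 1%:M) <> 0)%R.
Hypothesis det_add1 : (\det (N + 1%:M) <> 0)%R.
Let psi := zlat g h.

Lemma det_sub_sign (b : bool) : (\det (N - ((-1) ^+ b)%:M) <> 0)%R.
Proof.
by case: b; rewrite /= ?expr1 ?raddfN ?opprK.
Qed.

(** With [e] the sign by which [c] acts on translations, [psi] vanishes on the
  image of [D = (N - e) (N - 1)]: the factor [N - 1] makes the values
  translations, and [N - e] kills these.  As [D] times its adjugate is [det D],
  every value of [psi] has order dividing [det D]. *)
Lemma zlat_torsion x : psi x = 1 \/ flip (psi x).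
Proof.
pose e : int := ((-1) ^+ flip c)%R.
have psi_conj y : c * psi y * c^-1 = psi (N *m y)%R by apply: zlat_mul.
have translation y : exists z, psi ((N - 1%:M) *m y)%R = Dih false z.
  rewrite /psi mulmxBl mul1mx zlatD // zlatN // -/psi -psi_conj.
  exists (shift (c * psi y * c^-1 * (psi y)^-1)).
  move: (psi y) => [b z]; case: (c) => b' z'.
  by rewrite !dihV !dihM; congr Dih; case: b b' => [] [].
have killed y : psi ((N - e%:M) *m ((N - 1%:M) *m y))%R = 1.
  have [z zE] := translation y.
  rewrite /psi mulmxBl zlatD // zlatN // -/psi -psi_conj mul_scalar_mx.
  have -> : (e *: ((N - 1%:M) *m y) = ((N - 1%:M) *m y) *~ e)%R.
    by rewrite -scaler_int intz.
  by rewrite /psi zlat_mulz // -/psi zE conj_translation mulgV.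
set D := ((N - e%:M) *m (N - 1%:M))%R.
apply: (@dih_torsion _ (\det D)%R).
  by rewrite det_mulmx => /eqP; rewrite mulf_eq0 => /orP[] /eqP;
    [apply: det_sub_sign|].
rewrite /psi -zlat_mulz // -/psi -(killed (\adj D *m x)%R) !mulmxA mul_mx_adj.
by rewrite mul_scalar_mx -scaler_int intz.
Qed.

(** The nontrivial values of [psi] are reflections, and two of them coincide
  because their product is a translation, hence trivial.  Conjugation by [c] and
  [d] preserves nontriviality, so it fixes the only possible one, [r]; the
  assumption then makes [r] commute with a translation of shift [1]. *)
Lemma lattice_killed :
    (forall r, commute r g -> commute r h -> commute r c -> commute r d ->
       commute r (Dih false 1)) ->
  g = 1 /\ h = 1.
Proof.
move=> central.
have psi_refl x y : psi x <> 1 -> psi y <> 1 -> psi x = psi y.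
  move=> x1 y1.
  have [//|fx] := zlat_torsion x; have [//|fy] := zlat_torsion y.
  have [|] := zlat_torsion (x + y)%R; rewrite /psi zlatD // -!/psi.
    by rewrite -(reflection_invol fy) => /mulIg.
  by rewrite flipM fx fy.
have conj_comm x u (B : 'M[int]_2) : psi x <> 1 ->
    u * psi x * u^-1 = psi (B *m x)%R -> commute (psi x) u.
  move=> x1 e; apply: (mulIg u^-1); rewrite mulgK e.
  apply: psi_refl => //; rewrite -e => /(canRL (mulgK _)).
  by rewrite invgK mul1g -[RHS](mulg1 u) => /mulgI.
have psi1 x : psi x = 1.
  have [//|fx] := zlat_torsion x.
  have x1 : psi x <> 1 by move=> e; move: fx; rewrite e.
  case: (reflection_not_central fx); apply: central.
  - apply/commute_sym; rewrite /psi /zlat; apply: commuteM.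
      exact/commute_zexp/commute_refl.
    exact: commute_zexp.
  - rewrite /psi /zlat; apply/commute_sym/commuteM; apply: commute_zexp.
      exact: commute_sym.
    exact: commute_refl.
  - by apply: (conj_comm _ _ N) => //; apply: zlat_mul.
  - by apply: (conj_comm _ _ M) => //; apply: zlat_mul.
split.
  have := psi1 (delta_mx 0%R 0%R); rewrite /psi /zlat !mxE /= mulg1.
  by rewrite expg1.
have := psi1 (delta_mx 1%R 0%R); rewrite /psi /zlat !mxE /= mul1g.
by rewrite expg1.
Qed.

End LatticeImage.

(** * The projection onto the infinite dihedral group *)
Section Projection.
Local Open Scope quotient_scope.
Local Open Scope group_scope.
Variables (N M : 'M[int]_2) (k k' : 'cV[int]_2).
Let rels := pi6_rel N M k k'.

Lemma weval_lattice (G : groupType) (v : pi6_gen -> G) x :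
  weval v (pi6_lattice x) = zlat (v (pi6_a 0%R)) (v (pi6_a 1%R)) x.
Proof. by rewrite /pi6_lattice wevalM !weval_wexpz !weval_letter. Qed.

Definition dih_val (s : pi6_gen) : dihedral :=
  match s with
  | pi6_a _ => 1 | pi6_alpha => Dih false 1 | pi6_beta => Dih true 0
  end.

Lemma zexp1 n : zexp (1 : dihedral) n = 1.
Proof. by rewrite [in LHS]dih1 zexp_translation mul0r. Qed.

Lemma dih_val_rels u v : rels u v -> weval dih_val u = weval dih_val v.
Proof.
have lat1 x : weval dih_val (pi6_lattice x) = 1.
  by rewrite weval_lattice /zlat !zexp1 mulg1.
by case=> [|i|i||]; rewrite /commg /conjg ?expg2
  !(lat1, wevalM, wevalV, weval_letter) //= ?invg1 ?mulg1 ?mul1g ?mulgV.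
Qed.

Definition to_dih : presented rels -> dihedral :=
  @pres_lift _ _ rels dih_val.

Lemma to_dihM : {morph to_dih : x y / x * y}.
Proof. exact: (pres_liftM dih_val_rels). Qed.

Lemma to_dih_gen s : to_dih (pres_gen rels s) = dih_val s.
Proof. exact: (pres_lift_gen dih_val_rels). Qed.

Lemma to_dih_onto u : exists x, to_dih x = u.
Proof.
case: u => b n.
exists (\pi_(presented rels) (wexpz pi6_word_alpha n * pi6_word_beta ^+ b)).
rewrite /to_dih (pres_lift_pi dih_val_rels) wevalM weval_wexpz wevalX.
rewrite !weval_letter /= zexp_translation.
by case: b; rewrite ?expg1 ?expg0 ?mulg1 ?dihM /= ?mulr0 ?addr0 mul1r.
Qed.

End Projection.

(** * Endomorphisms of the infinite dihedral group *)
Section DihedralEndomorphism.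
Local Open Scope group_scope.

(** The translation by [1] goes to that by [d], and the reflection [u |-> - u]
  to [u |-> - u + c]. *)
Definition dih_endo (d c : int) (u : dihedral) : dihedral :=
  Dih (flip u) (d * shift u + c *+ flip u)%R.

Lemma dih_endoM d c : {morph dih_endo d c : u v / u * v}.
Proof.
move=> [a x] [b y]; rewrite /dih_endo dihM /= dihM; congr Dih.
by case: a b => [] [] /=; rewrite ?mulN1r ?mul1r ?mulr0n ?mulr1n; lia.
Qed.

(** The flip [e] is that of the sign by which the endomorphism acts on
  translations: then twisted conjugation by translations is trivial on elements
  of flip [e], and all reflections act on them in the same way.  With the other
  sign, conjugation by translations would leave only finitely many classes among these
  elements. *)
Lemma dih_endo_twisted (e : bool) (z m n : int) (u : dihedral) :
    Dih e m = u * Dih e n * (dih_endo ((-1) ^+ e)%R z u)^-1 ->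
  (m = n \/ m = - n - (-1) ^+ e * z)%R.
Proof.
case: u => [b j]; rewrite /dih_endo dihV !dihM /=.
by case: e b => [] [] /= [->]; rewrite ?expr0 ?expr1; lia.
Qed.

End DihedralEndomorphism.

Section Factor.
Local Open Scope quotient_scope.
Local Open Scope group_scope.
Variables (N M : 'M[int]_2) (k k' : 'cV[int]_2).
Let rels := pi6_rel N M k k'.
Hypothesis det_sub1 : (\det (N - 1%:M) <> 0)%R.
Hypothesis det_add1 : (\det (N + 1%:M) <> 0)%R.
Variable f : presented rels -> dihedral.
Hypothesis fM : {morph f : x y / x * y}.
Hypothesis f_onto : forall u, exists x, f x = u.
Let v := f \o pres_gen rels.
Let g := v (pi6_a 0%R).
Let h := v (pi6_a 1%R).
Let c := v pi6_alpha.
Let d := v pi6_beta.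

Lemma ord2E (i : 'I_2) : i = 0%R \/ i = 1%R.
Proof. by case: i => [[|[|]] //= lt2]; [left|right]; apply: val_inj. Qed.

(** As [f] is onto, the images of the generators generate [dihedral]. *)
Lemma image_closed (P : dihedral -> Prop) :
    P 1 -> (forall u w, P u -> P w -> P (u * w)) -> (forall u, P u -> P u^-1) ->
    P g -> P h -> P c -> P d ->
  forall u, P u.
Proof.
move=> P1 PM PV Pg Ph Pc Pd u; have [x <-] := f_onto u; move: x.
apply: presented_ind.
- by case=> [i||] //; have [->|->] := ord2E i.
- by rewrite (pres_morph1 fM).
- by move=> x y; rewrite fM; apply: PM.
- by move=> x; rewrite (pres_morphV fM); apply: PV.
Qed.

(** By surjectivity, what commutes with the images of the generators is central
  in [dihedral]. *)
Lemma image_lattice : g = 1 /\ h = 1.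
Proof.
have rel w1 w2 : rels w1 w2 -> weval v w1 = weval v w2.
  exact: (weval_rel fM).
apply: (@lattice_killed N M g h c d) => //.
- have := rel _ _ (Pi6Comm N M k k'); rewrite /commg /conjg.
  rewrite !(wevalM, wevalV, weval_letter) -/g -/h => e.
  by apply/commgP/eqP; rewrite /commg /conjg.
- have := rel _ _ (Pi6Alpha N M k k' 0%R).
  by rewrite weval_lattice !(wevalM, wevalV, weval_letter).
- have := rel _ _ (Pi6Alpha N M k k' 1%R).
  by rewrite weval_lattice !(wevalM, wevalV, weval_letter).
- have := rel _ _ (Pi6Beta N M k k' 0%R).
  by rewrite weval_lattice !(wevalM, wevalV, weval_letter).
- have := rel _ _ (Pi6Beta N M k k' 1%R).
  by rewrite weval_lattice !(wevalM, wevalV, weval_letter).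
move=> r rg rh rc rd.
apply: (@image_closed (commute r)) => //.
- exact: commute1.
- by move=> u w; apply: commuteM.
- by move=> u; apply: commuteV.
Qed.

Lemma image_beta2 : d * d = 1.
Proof.
have := weval_rel fM (Pi6Beta2 N M k k').
rewrite weval_lattice wevalX weval_letter expg2 -/v -/d -/g -/h.
by have [-> ->] := image_lattice; rewrite /zlat !zexp1 mulg1.
Qed.

Lemma image_beta_alpha : d * c * d^-1 = c^-1.
Proof.
have := weval_rel fM (Pi6BetaAlpha N M k k').
rewrite !(weval_lattice, wevalM, wevalV, weval_letter) -/v -/c -/d -/g -/h.
by have [-> ->] := image_lattice; rewrite /zlat !zexp1 !mul1g.
Qed.

(** If [c] were a reflection, then [d], which commutes with [c] and squares to
  [1], would be [1] or [c], and the image of [f] would have two elements. *)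
Lemma image_alpha_flip : flip c = false.
Proof.
apply/negbTE/negP => fc.
have cc : c * c = 1 by apply: reflection_invol.
have cV : c^-1 = c by apply/esym/(mulgI c); rewrite mulgV.
have d1c : d = 1 \/ d = c.
  have := image_beta_alpha; have := image_beta2; rewrite cV.
  move: fc; case: (c) (d) => [[] zc] [[] zd] // _; rewrite dihV !dihM dih1 /=.
    by rewrite expr0 expr1 => _ [e]; right; congr Dih; lia.
  by rewrite expr0 => -[e] _; left; congr Dih; lia.
have : Dih false 1 = 1 \/ Dih false 1 = c.
  apply: (@image_closed (fun u => u = 1 \/ u = c)).
  - by left.
  - by move=> u w [->|->] [->|->]; rewrite ?mul1g ?mulg1; auto.
  - by move=> u [->|->]; rewrite ?invg1 ?cV; auto.
  - by left; case: image_lattice.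
  - by left; case: image_lattice.
  - by right.
  - exact: d1c.
case=> // e; move: cc; rewrite -e dihM dih1 => -[]; lia.
Qed.

(** Otherwise [f] would take only translations as values. *)
Lemma image_beta_flip : flip d.
Proof.
apply/negP => /negP/negbTE fd.
have : flip (Dih true 0) = false.
  apply: (@image_closed (fun u => flip u = false)) => //.
  - by move=> u w; rewrite flipM => -> ->.
  - by case: image_lattice => ->.
  - by case: image_lattice => _ ->.
  - exact: image_alpha_flip.
by [].
Qed.

(** The translations in the image of [f] are the powers of [c], so surjectivity
  makes the shift of [c] equal to [1] or [-1]. *)
Lemma factor_to_dih : exists e : bool, exists z : int,
  forall x, f x = dih_endo ((-1) ^+ e)%R z (to_dih x).
Proof.
pose j := shift c; pose z := shift d.
have fE x : f x = dih_endo j z (to_dih x).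
  move: x; apply: presented_ind.
  - have [g1 h1] := image_lattice.
    case=> [i||]; rewrite to_dih_gen /dih_endo /=.
    + by have [->|->] := ord2E i; rewrite ?[LHS]g1 ?[LHS]h1 mulr0.
    + rewrite mulr1 addr0 /j -image_alpha_flip -[LHS]/c; by case: (c).
    + by rewrite mulr0 add0r /z -image_beta_flip -[LHS]/d; case: (d).
  - rewrite (pres_morph1 fM) (pres_morph1 (@to_dihM N M k k')).
    by rewrite /dih_endo /= mulr0.
  - by move=> x y; rewrite fM to_dihM dih_endoM => -> ->.
  - move=> x e; apply: (mulgI (f x)).
    rewrite -fM mulgV (pres_morph1 fM) e -dih_endoM -to_dihM mulgV.
    rewrite (pres_morph1 (@to_dihM N M k k')).
    by rewrite /dih_endo /= mulr0.
have [x] := f_onto (Dih false 1); rewrite fE /dih_endo => -[].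
case: flip => //= _; rewrite addr0 => j1.
have : (j = 1 \/ j = -1)%R.
  have : (`|j| * `|shift (to_dih x)| = 1)%N by rewrite -abszM j1.
  by move/eqP; rewrite muln_eq1 => /andP[/eqP jn _]; lia.
by case=> jE; [exists false | exists true]; exists z => w; rewrite fE jE.
Qed.

End Factor.

(** * Reidemeister numbers *)
Section ReidemeisterInfinite.
Local Open Scope group_scope.
Local Open Scope classical_set_scope.

Lemma reidemeister_infinite (G : groupType) (phi : G -> G) (s : nat -> G) :
    phi 1 = 1 -> (forall m n, twisted_conj phi (s m) (s n) -> m = n) ->
  reidemeister_number phi = +oo%E.
Proof.
move=> phi1 s_inj; rewrite /reidemeister_number; case: asboolP => // fin.
pose cls n := [set y | twisted_conj phi (s n) y].
have cls_inj : injective cls.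
  move=> m n e; apply: s_inj; rewrite -[twisted_conj _ _ _]/(cls m (s n)) e.
  by exists 1; rewrite phi1 invg1 mulg1 mul1g.
case: infinite_nat; rewrite -(eq_finite_set (inj_card_eq (in2W cls_inj))).
by apply: sub_finite_set fin => _ [n _ <-]; exists (s n).
Qed.

End ReidemeisterInfinite.

(** * The integer square root *)
Section SquareRoot.
Variable R : realType.

Lemma det2 (S : comPzRingType) (B : 'M[S]_2) :
  \det B = B 0 0 * B 1 1 - B 0 1 * B 1 0.
Proof.
rewrite (expand_det_row _ 0) big_ord_recl big_ord1 /cofactor !det_mx11 !mxE /=.
have -> : lift ord0 ord0 = 1%R :> 'I_2 by apply: val_inj.
have -> : lift 1%R 0 = 0%R :> 'I_2 by apply: val_inj.
rewrite -[(0 + 0)%N]/0%N -[(0 + bump 0 0)%N]/1%N.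
by rewrite expr0 expr1 mul1r mulN1r mulrN.
Qed.

Lemma tr2 (S : pzSemiRingType) (B : 'M[S]_2) : \tr B = B 0 0 + B 1 1.
Proof.
rewrite /mxtrace big_ord_recl big_ord1.
by have -> : lift ord0 ord0 = 1%R :> 'I_2 by apply: val_inj.
Qed.

(** As [det (A + 1) = det A + tr A + 1 = tr A + 2], dividing [A + 1] by a square
  root of [tr A + 2] makes the determinant [1]; the trace of [A + 1] is
  [tr A + 2] as well. *)
Lemma sqrt_det_tr (A N : 'M[int]_2) :
    \det A = 1 -> 2 < \tr A ->
    map_mx intr N =
      - (Num.sqrt ((A 0 0 + A 1 1 + 2)%:~R : R))^-1 *: map_mx intr (A + 1%:M) ->
  \det N = 1 /\ \tr N ^+ 2 = \tr A + 2.
Proof.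
rewrite !det2 !tr2 => detA trA NE.
set q := (Num.sqrt _)^-1 in NE.
set t : R := (A 0 0 + A 1 1 + 2)%:~R in q NE.
have {}trA : 2 < A 0 0 + A 1 1 by [].
have t0 : 0 < t by rewrite ltr0z; lia.
have q2 : q ^+ 2 * t = 1.
  by rewrite /q exprVn sqr_sqrtr ?ltW // mulVf // gt_eqF.
have entry i j : (N i j)%:~R = - q * (A i j + (i == j)%:R)%:~R :> R.
  by move/matrixP/(_ i j): NE; rewrite !mxE.
have detA' : (A 0 0)%:~R * (A 1 1)%:~R - (A 0 1)%:~R * (A 1 0)%:~R = 1 :> R.
  by rewrite -!rmorphM -rmorphB detA.
have tE : t = (A 0 0)%:~R + (A 1 1)%:~R + 2 :> R by rewrite /t !rmorphD.
split; apply: (@intr_inj R).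
  rewrite rmorphB !rmorphM /= !entry /= !rmorphD /= -[RHS]q2 tE.
  rewrite (_ : 1%:~R = 1) // (_ : 0%:~R = 0) //.
  transitivity (q ^+ 2 *
    (((A 0 0)%:~R * (A 1 1)%:~R - (A 0 1)%:~R * (A 1 0)%:~R)
    + (A 0 0)%:~R + (A 1 1)%:~R + 1)); first by ring.
  by rewrite detA'; ring.
rewrite rmorphXn rmorphD /= !entry /= !rmorphD /= -[RHS]/(_ + _ + 2) -tE.
rewrite (_ : 1%:~R = 1) //.
by transitivity (q ^+ 2 * t * t); [rewrite tE; ring | rewrite q2 mul1r].
Qed.

(** An eigenvalue [1] or [-1] of [N] would give [tr N = 2] or [tr N = -2] as
  [det N = 1], so [tr A = (tr N)^2 - 2 = 2]. *)
Lemma sqrt_eigenvalues (A N : 'M[int]_2) :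
    \det A = 1 -> 2 < \tr A ->
    map_mx intr N =
      - (Num.sqrt ((A 0 0 + A 1 1 + 2)%:~R : R))^-1 *: map_mx intr (A + 1%:M) ->
  \det (N - 1%:M) <> 0 /\ \det (N + 1%:M) <> 0.
Proof.
move=> detA trA /(sqrt_det_tr detA trA)[]; rewrite !det2 tr2 => detN trN.
have {}trN : (N 0 0 + N 1 1) ^+ 2 = \tr A + 2 by [].
have {}detN : N 0 0 * N 1 1 - N 0 1 * N 1 0 = 1 by [].
rewrite !mxE /=; split=> e.
  have trNE : N 0 0 + N 1 1 = 2 by lia.
  by rewrite trNE in trN; lia.
have trNE : N 0 0 + N 1 1 = -2 by lia.
by rewrite trNE in trN; lia.
Qed.

End SquareRoot.

Unset Implicit Arguments.

Theorem theorem8p2 (R : realType) (A N M : 'M[int]_2) (k k' : 'cV[int]_2)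
  (detA : \det A = 1)
  (trA : 2 < \tr A)
  (NE : map_mx intr N =
        - (Num.sqrt ((A 0 0 + A 1 1 + 2)%:~R : R))^-1 *: map_mx intr (A + 1%:M))
  (trM : \tr M = 0)
  (detM : \det M = -1)
  (MAM : M *m A *m invmx M = invmx A)
  (kM : (1%:M - M) *m k = 0)
  (kNM : (N - M) *m (k' - k) = 0) :
  R_infinity (Pi6 N M k k').
Proof.
have [det_sub1 det_add1] := sqrt_eigenvalues detA trA NE.
move=> phi [psi phiK psiK].
have phiM : {morph phi : x y / (x * y)%g} by exact: gmulfM.
pose p : Pi6 N M k k' -> dihedral := @to_dih N M k k'.
have pM : {morph p : x y / (x * y)%g} by exact: to_dihM.
have p_onto u : exists x, p x = u by exact: to_dih_onto.
have fM : {morph p \o phi : x y / (x * y)%g}.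
  by move=> x y /=; rewrite phiM pM.
have f_onto u : exists x, (p \o phi) x = u.
  by have [x <-] := p_onto u; exists (psi x); rewrite /= psiK.
have [e [z fE]] := factor_to_dih det_sub1 det_add1 fM f_onto.
(* From [|z|] on, the shifts [m] and [- m - (-1)^e z] of a class cannot both
   occur unless they are equal. *)
pose rep n := sval (cid (p_onto (Dih e (`|z| + n)%N))).
have repE n : p (rep n) = Dih e (`|z| + n)%N by rewrite /rep; case: cid.
apply: (@reidemeister_infinite _ phi rep).
  exact: (pres_morph1 phiM).
move=> m n [x]; move/(congr1 p); rewrite !pM (pres_morphV pM) !repE.
rewrite -[p (phi x)]/((p \o phi) x) fE => /dih_endo_twisted.
by case: (e) => /=; rewrite ?expr0 ?expr1; lia.
Qed.
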